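(* Let $n\ge 1$ and let $\lambda\vdash n$ be a Young diagram. Then the induced representations $\mathrm{Ind}_{H(\lambda)}^{\mathfrak S_n}\mathbf 1$ and $\mathrm{Ind}_{V(\lambda)}^{\mathfrak S_n}\mathbf{sgn}$ have exactly one irreducible representation of $\mathfrak S_n$ (up to equivalence) occurring in the decompositions of both of them, namely $\pi_\lambda$, and $\pi_\lambda$ occurs with multiplicity one in each of the two induced representations.
   Context: All representations are finite-dimensional and over $\mathbb C$; $\mathfrak S_n$ is the symmetric group on $\{1,\dots,n\}$. $\lambda\vdash n$ means a Young diagram with $n$ cells (equivalently a partition of $n$). Fix any filling $t_\lambda$ of the cells of $\lambda$ by the numbers $1,\dots,n$ (each used once). $H(\lambda)\subset\mathfrak S_n$ is the Young subgroup of permutations preserving each row of $t_\lambda$ (as a set), and $V(\lambda)$ is the Young subgroup of permutations preserving each column of $t_\lambda$; other fillings give conjugate subgroups. $\mathbf 1$ is the one-dimensional identity representation, and $\mathbf{sgn}$ is the restriction of the sign representation. The irreducible representation $\pi_\lambda$ is the one associated with $\lambda$ by the Gelfand–Tsetlin (Okounkov–Vershik) approach: $\pi_\lambda$ is the irreducible representation of $\mathfrak S_n$ having a basis $(v_T)$ indexed by the standard Young tableaux $T$ of shape $\lambda$, such that for each $i=1,\dots,n$ the Jucys–Murphy element $X_i=(1\,i)+(2\,i)+\dots+(i-1\,i)$ acts on $v_T$ by multiplication by the content (column index minus row index) of the cell of $T$ containing $i$. It is assumed known that $\lambda\mapsto\pi_\lambda$ is a bijection between Young diagrams with $n$ cells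 and equivalence classes of irreducible complex representations of $\mathfrak S_n$, and that the branching of these representations is given by the Young graph: the restriction of $\pi_\lambda$ to $\mathfrak S_{n-1}$ is the multiplicity-free sum of the $\pi_\gamma$ over diagrams $\gamma$ obtained from $\lambda$ by removing one cell. *)

(* Defs.v *)
From HB Require Import structures.
From mathcomp Require Import all_boot all_order all_fingroup all_algebra.
From mathcomp Require Import mxrepresentation.
From mathcomp Require Export complex reals.

Set Implicit Arguments.
Unset Strict Implicit.
Unset Printing Implicit Defensive.

Import GroupScope GRing.Theory.
Local Open Scope ring_scope.

Section Induction.

Variables (F : fieldType) (gT : finGroupType) (G H : {group gT}).
Hypothesis sHG : H \subset G.
Variables (d : nat) (rH : mx_representation F H d).

(* Representations act on row vectors on the right. With r_i the chosen       *)
(* representatives of the right cosets H :* r_i of H in G, the module induced *)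
(* from V is the direct sum of the V (x) r_i. If r_i * x = h * r_j with h in  *)
(* H, then x sends v (x) r_i to (v *m rH h) (x) r_j.                          *)
Definition coset_rep (i : 'I_#|rcosets H G|) : gT := repr (enum_val i).

Definition ind_mx (x : gT) : 'M[F]_(\sum_(i < #|rcosets H G|) d) :=
  \mxblock_(i < #|rcosets H G|, j < #|rcosets H G|)
    (let h := (coset_rep i * x * (coset_rep j)^-1)%g in
     if h \in H then rH h else 0).

Lemma coset_repP i : coset_rep i \in G /\ enum_val i = (H :* coset_rep i)%g.
Proof.
rewrite /coset_rep; have := enum_valP i.
case/rcosetsP=> y yG ->; split; last by rewrite rcoset_repr.
have: repr (H :* y)%g \in (H :* y)%g by rewrite mem_repr_rcoset.
by case/rcosetP=> h hH ->; rewrite groupM // (subsetP sHG).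
Qed.

Lemma coset_rep_mem i j :
  ((coset_rep i * (coset_rep j)^-1)%g \in H) = (i == j).
Proof.
apply/idP/eqP => [|->]; last by rewrite mulgV group1.
rewrite -mem_rcoset => ij; apply/enum_val_inj.
have [_ ->] := coset_repP i; have [_ ->] := coset_repP j.
exact/rcoset_eqP.
Qed.

Lemma coset_rep_exists y : y \in G ->
  exists j, forall k, ((y * (coset_rep k)^-1)%g \in H) = (k == j).
Proof.
move=> yG; have yR : (H :* y)%g \in rcosets H G by apply/rcosetsP; exists y.
exists (enum_rank_in yR (H :* y)%g) => k; rewrite -mem_rcoset.
have [_ <-] := coset_repP k.
apply/idP/eqP => [yk|->]; last by rewrite enum_rankK_in // rcoset_refl.
apply/enum_val_inj; rewrite enum_rankK_in //.
have [_ E] := coset_repP k; rewrite E in yk *.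
by apply/esym/rcoset_eqP.
Qed.

Lemma ind_mx_repr : mx_repr G ind_mx.
Proof.
split=> [|x y xG yG].
  rewrite -mxdiagZ; apply: eq_mxblock => i j.
  rewrite mulg1 /= coset_rep_mem; case: (eqVneq i j) => // ij.
  by rewrite -ij mulgV repr_mx1 conform_mx_id.
rewrite mul_mxblock; apply: eq_mxblock => i j /=.
have [riG _] := coset_repP i.
have [k0 k0P] := coset_rep_exists (groupM riG xG).
rewrite (bigD1 k0) //= k0P eqxx big1 ?addr0; last first.
  by move=> k /negPf kk0; rewrite k0P kk0 mul0mx.
have k0H : (coset_rep i * x * (coset_rep k0)^-1)%g \in H by rewrite k0P.
set a := (coset_rep i * x * (coset_rep k0)^-1)%g in k0H *.
set b := (coset_rep k0 * y * (coset_rep j)^-1)%g.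
have -> : (coset_rep i * (x * y) * (coset_rep j)^-1 = a * b)%g.
  by rewrite /a /b !mulgA mulgKV.
rewrite groupMl //; case: ifP => bH; last by rewrite mulmx0.
by rewrite repr_mxM.
Qed.

Definition ind_repr := MxRepresentation ind_mx_repr.

End Induction.

Section Multiplicity.

Variables (F : fieldType) (gT : finGroupType) (G : {group gT}).

(* tau is the internal direct sum of simple submodules U i, exactly m of      *)
(* which afford a representation equivalent to sigma.                         *)
Definition has_multiplicity d (tau : mx_representation F G d)
    e (sigma : mx_representation F G e) (m : nat) : Prop :=
  exists (k : nat) (U : 'I_k -> 'M[F]_d) (A : {set 'I_k}),
    [/\ forall i, mxsimple tau (U i),
        (\sum_i U i :=: 1%:M)%MS,
        mxdirect (\sum_i U i)%MS,
        forall i, i \in A <->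
          exists Umod : mxmodule tau (U i), mx_rsim (submod_repr Umod) sigma
      & #|A| = m].

Definition occurs_in e (sigma : mx_representation F G e)
    d (tau : mx_representation F G d) : Prop :=
  exists2 m, (0 < m)%N & has_multiplicity tau sigma m.

End Multiplicity.

Section SymmetricGroup.

Variables (F : fieldType) (n : nat).

Lemma triv_mx_repr (G : {group 'S_n}) : mx_repr G (fun=> 1%:M : 'M[F]_1).
Proof. by split=> // x y _ _; rewrite mulmx1. Qed.
Definition triv_repr (G : {group 'S_n}) := MxRepresentation (triv_mx_repr G).

Lemma sgn_mx_repr :
  mx_repr [set: 'S_n] (fun s : 'S_n => ((-1) ^+ odd_perm s)%:M : 'M[F]_1).
Proof.
split=> [|x y _ _]; first by rewrite odd_perm1 expr0.
by rewrite odd_permM signr_addb scalar_mxM.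
Qed.
Definition sgn_repr := MxRepresentation sgn_mx_repr.

Definition sgn_res (G : {group 'S_n}) := subg_repr sgn_repr (subsetT G).

Definition fiber_stab (f : 'I_n -> 'I_n) : {set 'S_n} :=
  [set s : 'S_n | [forall i, f (s i) == f i]].

Lemma fiber_stab_group_set f : group_set (fiber_stab f).
Proof.
apply/group_setP; split=> [|s t]; first by rewrite inE; apply/forallP=> i; rewrite perm1.
rewrite !inE => /forallP fs /forallP ft; apply/forallP=> i.
by rewrite permM (eqP (ft _)).
Qed.
Canonical fiber_stab_group f := Group (fiber_stab_group_set f).

End SymmetricGroup.

Definition is_partition (n : nat) (lam : seq nat) : bool :=
  [&& sorted geq lam, 0%N \notin lam & sumn lam == n].

(* Cells are pairs (row, column), counted from 0; both coordinates of a cell  *)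
(* of a diagram with n cells are smaller than n.                              *)
Definition diagram (n : nat) (lam : seq nat) : {set 'I_n * 'I_n} :=
  [set c : 'I_n * 'I_n | (c.2 < nth 0%N lam c.1)%N].

(* A filling is given by the cell t i that contains i; the entries 1, ..., n  *)
(* are shifted to 0, ..., n - 1.                                              *)
Definition is_filling (n : nat) (lam : seq nat)
    (t : {ffun 'I_n -> 'I_n * 'I_n}) : bool :=
  injectiveb t && (t @: [set: 'I_n] == diagram n lam).

Definition is_standard (n : nat) (lam : seq nat)
    (t : {ffun 'I_n -> 'I_n * 'I_n}) : bool :=
  is_filling lam t &&
  [forall i, forall j,
     (((t i).1 == (t j).1) && ((t i).2 < (t j).2)%N ==> (i < j)%N) &&
     (((t i).2 == (t j).2) && ((t i).1 < (t j).1)%N ==> (i < j)%N)].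

Definition syt (n : nat) (lam : seq nat) :=
  {t : {ffun 'I_n -> 'I_n * 'I_n} | is_standard lam t}.

Definition row_group (n : nat) (t : {ffun 'I_n -> 'I_n * 'I_n}) :=
  fiber_stab_group (fun i => (t i).1).

Definition col_group (n : nat) (t : {ffun 'I_n -> 'I_n * 'I_n}) :=
  fiber_stab_group (fun i => (t i).2).

Section GelfandTsetlin.

Variables (F : fieldType) (n d : nat).
Variable pi : mx_representation F [set: 'S_n] d.

Definition jucys_murphy (i : 'I_n) : 'M[F]_d :=
  \sum_(j < n | (j < i)%N) pi (tperm j i).

Definition content (c : 'I_n * 'I_n) : F := (c.2)%:R - (c.1)%:R.

(* In 'S_n the product s * t means "s, then t", so a right action of 'S_n on  *)
(* row vectors is a left action for the usual composition of permutations.    *)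
(* The predicate characterizes pi up to equivalence as the irreducible        *)
(* representation attached to lam by its Gelfand-Tsetlin basis.               *)
Definition is_irr_of_shape (lam : seq nat) : Prop :=
  mx_irreducible pi /\
  exists v : syt n lam -> 'rV[F]_d,
    basis_of {: 'rV[F]_d} [seq v T | T : syt n lam] /\
    forall (T : syt n lam) (i : 'I_n),
      v T *m jucys_murphy i = content (sval T i) *: v T.

End GelfandTsetlin.

(* Main.v *)
Require Import Defs.
From mathcomp Require Import all_boot all_order all_fingroup all_algebra.
From mathcomp Require Import mxrepresentation complex reals.
From mathcomp Require Import boolp pgroup zify.

Set Implicit Arguments.
Unset Strict Implicit.
Unset Printing Implicit Defensive.

Import GroupScope GRing.Theory.
Local Open Scope ring_scope.

(** Write W for the representation induced from the trivial character of the
row group H, and W' for the one induced from the sign of the column group V.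
The theorem follows from two facts: the intertwiners from W to W' form a
space of dimension at most one, and pi is a quotient of both W and W'.

By complete reducibility, every pair of isomorphic simple summands, one of W
and one of W', gives an intertwiner that kills the other summands of W and
has the chosen summand of W' as its image, and different pairs give
independent intertwiners. So the first fact leaves room for at most one pair,
and by the second fact there is a pair of summands isomorphic to pi. Hence pi
has multiplicity one on both sides and nothing else is common
([unique_common_constituent]).

The first fact is Mackey's argument. An intertwiner amounts to a function Phi
on the symmetric group with Phi (h g v) = sgn v Phi g for h in H and v in V.
If g sends two entries of one row into one column, the transposition of these
entries gives Phi g = - Phi g, so Phi g = 0. Otherwise a count of cells shows
that g lies in H V ([row_col_factorization]), so that Phi g is determined by
Phi 1 ([hom_le1_of_double_cosets]).

For the second fact, Frobenius reciprocity asks for a nonzero vector of pi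
that is fixed by H, and for one on which V acts by its sign. The
Gelfand-Tsetlin vector of the tableau obtained by reading the diagram row by
row (column by column for V) is such a vector, up to a translation that
brings its row group to H. It suffices to test the adjacent transpositions s
of two entries i, i + 1 in one line. The commutation relations between s and
the Jucys-Murphy elements show that s v - v (for a row) or s v + v (for a
column), if nonzero, would be a joint eigenvector whose eigenvalues are the
contents of the tableau with entries i and i + 1 exchanged
([adjacent_defect_weights]). Contents determine a standard tableau, and the
exchanged tableau is not standard ([swapped_standard_absurd]). So s v = v, or
s v = - v, and these s generate the group ([fiber_stab_generated]). *)

(** * Intertwiners and common constituents *)

Section Intertwiners.

Variables (F : fieldType) (gT : finGroupType) (G : {group gT}).

Definition intertwines m n (rG : mx_representation F G m)
    (rH : mx_representation F G n) (B : 'M[F]_(m, n)) : Prop :=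
  forall x, x \in G -> rG x *m B = B *m rH x.

(** Schur's lemma between two different representations: the kernel and the
image of an intertwiner are submodules, so a nonzero one is bijective. *)
Lemma Schur_rsim m n (rG : mx_representation F G m)
    (rH : mx_representation F G n) (B : 'M_(m, n)) :
  mx_irreducible rG -> mx_irreducible rH -> intertwines rG rH B -> B != 0 ->
  mx_rsim rG rH.
Proof.
case/mx_irrP=> _ irrG /mx_irrP[_ irrH] homB nzB.
have kerB0 : kermx B = 0.
  apply/eqP; apply: contraNT nzB => nzK.
  have modK : mxmodule rG (kermx B).
    apply/mxmoduleP=> x Gx; apply/sub_kermxP.
    by rewrite -mulmxA homB // mulmxA mulmx_ker mul0mx.
  have := irrG _ modK nzK; rewrite -sub1mx => /sub_kermxP.
  by rewrite mul1mx => ->.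
have freeB : row_free B by rewrite -kermx_eq0 kerB0.
have fullB : row_full B.
  rewrite /row_full -(genmxE B); apply: irrH.
    rewrite (eqmx_module _ (genmxE B)); apply/mxmoduleP=> x Gx.
    by rewrite -homB // submxMl.
  by rewrite -!mxrank_eq0 genmxE in nzB *.
exists B => //.
by rewrite -(eqP freeB) (eqP fullB).
Qed.

Lemma simple_hom_rsim m n (rG : mx_representation F G m)
    (rH : mx_representation F G n) (U : 'M_m) (modU : mxmodule rG U)
    (B : 'M_(m, n)) :
  mxsimple rG U -> mx_irreducible rH -> intertwines rG rH B ->
  U *m B != 0 -> mx_rsim (submod_repr modU) rH.
Proof.
move=> simU irrH homB nzUB.
apply: (@Schur_rsim _ _ _ _ (val_submod 1%:M *m B)) => //.
- exact/submod_mx_irr.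
- move=> x Gx; rewrite mulmxA -val_submodE.
  rewrite -[submod_repr modU x]mul1mx val_submodJ // -!mulmxA.
  by rewrite homB.
- apply: contraNneq nzUB => B0; rewrite -(in_submodK (submx_refl U)) /=.
  by rewrite val_submodE -mulmxA B0 mulmx0.
Qed.

Lemma submod_rsim m (rG : mx_representation F G m) (U V : 'M_m)
    (modU : mxmodule rG U) (modV : mxmodule rG V) :
  (U :=: V)%MS -> mx_rsim (submod_repr modU) (submod_repr modV).
Proof. by move=> eqUV; apply/mx_rsim_iso; apply: eqmx_iso. Qed.

(** The intertwiner is the projection onto [U] along [V], followed by the
given isomorphism from [U] to [U']. *)
Lemma intertwiner_onto_summand m n (rG : mx_representation F G m)
    (rH : mx_representation F G n) (U V : 'M_m) (U' : 'M_n)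
    (modU : mxmodule rG U) (modV : mxmodule rG V) (modU' : mxmodule rH U') :
  (U + V :=: 1%:M)%MS -> (U :&: V = 0)%MS ->
  mx_rsim (submod_repr modU) (submod_repr modU') ->
  exists B : 'M_(m, n),
    [/\ intertwines rG rH B, V *m B = 0 & (U *m B :=: U')%MS].
Proof.
move=> sumUV capUV [C eqrk freeC homC].
have fullC : row_full C by rewrite /row_full (eqP freeC) eqrk.
pose p := proj_mx U V; pose q : 'M_(m, \rank U) := in_submod U 1%:M.
pose v : 'M_(\rank U', n) := val_submod 1%:M.
have homp x : x \in G -> rG x *m p = p *m rG x.
  move=> Gx; have := proj_mx_hom capUV modU modV.
  by rewrite sumUV => /hom_mxP/(_ _ Gx); rewrite !mul1mx.
have homq x : x \in G -> p *m rG x *m q = p *m q *m submod_repr modU x.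
  move=> Gx; rewrite -!in_submodE in_submodJ //.
  by rewrite -[p]mul1mx proj_mx_sub.
have homv x : x \in G -> submod_repr modU' x *m v = v *m rH x.
  by move=> Gx; rewrite -val_submodE -val_submodJ // mul1mx.
have Vp : V *m p = 0 by rewrite proj_mx_0.
have Up : U *m p = U by rewrite proj_mx_id.
have fullq : row_full (U *m q).
  by rewrite -in_submodE /row_full mxrank_in_submod.
have defv : (v :=: U')%MS := val_submod1 U'.
clearbody p q v; exists (p *m q *m C *m v); split.
- move=> x Gx.
  rewrite !mulmxA homp // homq // -[in LHS](mulmxA (p *m q)) homC //.
  by rewrite mulmxA -[in LHS](mulmxA (p *m q *m C)) homv // mulmxA.
- by rewrite !mulmxA Vp !mul0mx.
- rewrite !mulmxA Up -mulmxA; apply: eqmx_trans (eqmxMfull _ fullq) _.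
  exact: eqmx_trans (eqmxMfull _ fullC) defv.
Qed.

(** Maschke's theorem; splitting off simple submodules one at a time needs a
decision whether a module is simple, hence the excluded middle. *)
Lemma semisimple_decomposition m (rG : mx_representation F G m) :
  [pchar F]^'.-group G ->
  exists (k : nat) (U : 'I_k -> 'M[F]_m),
    [/\ forall i, mxsimple rG (U i), (\sum_i U i :=: 1%:M)%MS
      & mxdirect (\sum_i U i)%MS].
Proof.
move=> pG; have redG := mx_Maschke_pchar rG pG.
have [[[I U /= simU sumU dxU]]|ns] := EM (inhabited (mxsemisimple rG 1%:M));
  last first.
  suff: false by [].
  by apply: (mx_reducible_semisimple (mxmodule1 rG) redG) => ss; case: ns.
pose h (i : 'I_#|I|) : I := enum_val i.
have hP : {on [pred i : I | true], bijective h}.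
  exact: onW_bij (enum_val_bij I).
exists #|I|, (U \o h); split=> [i||] //=.
  by move: sumU; rewrite (reindex h).
by move: dxU; rewrite !mxdirectE /= !(reindex h).
Qed.

Lemma direct_sum_complement m (rG : mx_representation F G m) k
    (U : 'I_k -> 'M[F]_m) (i : 'I_k) :
  (forall j, mxmodule rG (U j)) -> (\sum_j U j :=: 1%:M)%MS ->
  mxdirect (\sum_j U j)%MS ->
  exists V : 'M_m, [/\ mxmodule rG V, (U i + V :=: 1%:M)%MS, (U i :&: V = 0)%MS
                     & forall j, j != i -> (U j <= V)%MS].
Proof.
move=> modU sumU dxU; exists (\sum_(j | j != i) U j)%MS; split.
- exact: sumsmx_module.
- by move: sumU; rewrite (bigD1 i).
- exact: (mxdirect_sumsP dxU).
- by move=> j ji; rewrite (sumsmx_sup j).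
Qed.

Variables (m n d : nat) (rG : mx_representation F G m)
  (rH : mx_representation F G n) (pi : mx_representation F G d).
Hypothesis pG : [pchar F]^'.-group G.
Hypothesis hom_le1 : forall B1 B2 : 'M_(m, n),
  intertwines rG rH B1 -> intertwines rG rH B2 -> B1 != 0 ->
  exists c, B2 = c *: B1.

(** Each pair of isomorphic summands gives an intertwiner that vanishes on the
complement [V1] (or [V2]) and has image [U1'] (or [U2']). As these two
intertwiners are proportional and nonzero, they have the same kernel, which
excludes that [V1] contains [U2], and the same image. *)
Lemma common_constituents_eq (U1 V1 U2 V2 : 'M_m) (U1' U2' : 'M_n)
    (modU1 : mxmodule rG U1) (modV1 : mxmodule rG V1)
    (modU2 : mxmodule rG U2) (modV2 : mxmodule rG V2)
    (modU1' : mxmodule rH U1') (modU2' : mxmodule rH U2') :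
  mxsimple rH U1' -> mxsimple rH U2' ->
  (U1 + V1 :=: 1%:M)%MS -> (U1 :&: V1 = 0)%MS ->
  (U2 + V2 :=: 1%:M)%MS -> (U2 :&: V2 = 0)%MS ->
  mx_rsim (submod_repr modU1) (submod_repr modU1') ->
  mx_rsim (submod_repr modU2) (submod_repr modU2') ->
  ~~ (U2 <= V1)%MS /\ (U1' :=: U2')%MS.
Proof.
move=> simU1' simU2' sum1 cap1 sum2 cap2 sim1 sim2.
have [B1 [hom1 V1B1 U1B1]] := intertwiner_onto_summand modV1 sum1 cap1 sim1.
have [B2 [hom2 V2B2 U2B2]] := intertwiner_onto_summand modV2 sum2 cap2 sim2.
have [_ nz1 _] := simU1'; have [_ nz2 _] := simU2'.
have nzB1 : B1 != 0.
  by apply: contraNneq nz1 => B0; rewrite -(eqmx_eq0 U1B1) B0 mulmx0.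
have [c defB2] := hom_le1 hom1 hom2 nzB1.
have imB1 : (B1 <= U1')%MS.
  by rewrite -[B1]mul1mx -(eqmxMr _ sum1) addsmxMr V1B1 addsmx0 U1B1.
have sU21 : (U2' <= U1')%MS.
  by rewrite -U2B2 defB2 -scalemxAr scalemx_sub // mulmx_sub.
split; last first.
  apply/eqmxP; rewrite sU21 andbT.
  by have [_ _ -> //] := simU1'.
apply: contraNN nz2 => /submxP[D U2V1].
by rewrite -(eqmx_eq0 U2B2) defB2 U2V1 -scalemxAr -mulmxA V1B1 mulmx0 scaler0.
Qed.

Variables (P : 'M[F]_(m, d)) (Q : 'M[F]_(n, d)).
Hypotheses (irr_pi : mx_irreducible pi).
Hypotheses (homP : intertwines rG pi P) (nzP : P != 0).
Hypotheses (homQ : intertwines rH pi Q) (nzQ : Q != 0).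

(** A nonzero map cannot vanish on all the summands; on a summand where it
does not, Schur's lemma applies. *)
Lemma quotient_is_summand l (rL : mx_representation F G l) k
    (U : 'I_k -> 'M[F]_l) (simU : forall i, mxsimple rL (U i))
    (S : 'M_(l, d)) :
  (\sum_i U i :=: 1%:M)%MS -> intertwines rL pi S -> S != 0 ->
  exists i, mx_rsim (submod_repr (mxsimple_module (simU i))) pi.
Proof.
move=> sumU homS nzS.
have [i nzi | U0] := pickP (fun i => U i *m S != 0).
  by exists i; apply: simple_hom_rsim homS nzi.
case/eqP: nzS; rewrite -[S]mul1mx; apply/sub_kermxP; rewrite -sumU.
apply/sumsmx_subP=> i _; apply/sub_kermxP/eqP.
by have /negbFE := U0 i.
Qed.

Theorem unique_common_constituent :
  [/\ has_multiplicity rG pi 1, has_multiplicity rH pi 1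
    & forall e (rho : mx_representation F G e),
        mx_irreducible rho -> occurs_in rho rG -> occurs_in rho rH ->
        mx_rsim rho pi].
Proof.
have [k [U [simU sumU dxU]]] := semisimple_decomposition rG pG.
have [l [W [simW sumW dxW]]] := semisimple_decomposition rH pG.
have [i simi] := quotient_is_summand simU sumU homP nzP.
have [j simj] := quotient_is_summand simW sumW homQ nzQ.
have modU i' := mxsimple_module (simU i').
have [Vi [modVi sumi capi subi]] := direct_sum_complement i modU sumU dxU.
split.
- exists k, U, [set i]; split=> //; last by rewrite cards1.
  move=> i'; rewrite inE; split=> [/eqP-> | [modUi' simi']].
    by exists (mxsimple_module (simU i)).
  have [V' [modV' sum' cap' sub']] := direct_sum_complement i' modU sumU dxU.
  have [] := common_constituents_eq modVi modV' (simW j) (simW j)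
    sumi capi sum' cap'
    (mx_rsim_trans simi (mx_rsim_sym simj))
    (mx_rsim_trans simi' (mx_rsim_sym simj)).
  by move=> nsub _; apply: contraR nsub => /subi.
- exists l, W, [set j]; split=> //; last by rewrite cards1.
  move=> j'; rewrite inE; split=> [/eqP-> | [modWj' simj']].
    by exists (mxsimple_module (simW j)).
  have [_ eqW] := common_constituents_eq modVi modVi (simW j) (simW j')
    sumi capi sumi capi
    (mx_rsim_trans simi (mx_rsim_sym simj))
    (mx_rsim_trans simi (mx_rsim_sym simj')).
  apply/negPn/negP=> nj; have [_ nzj _] := simW j.
  case/eqP: nzj; apply/eqP; rewrite -submx0.
  rewrite -(mxdirect_sumsP dxW j isT) sub_capmx submx_refl /= eqW.
  by rewrite (sumsmx_sup j') // eq_sym.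
move=> e rho irr_rho [a a0 [k1 [U1 [A [simU1 sumU1 dxU1 defA cA]]]]].
move=> [b b0 [l1 [W1 [A' [simW1 sumW1 dxW1 defA' cA']]]]].
have [i1 /defA[modi1 simi1]] : exists i1, i1 \in A.
  by apply/set0Pn; rewrite -card_gt0 cA.
have [j1 /defA'[modj1 simj1]] : exists j1, j1 \in A'.
  by apply/set0Pn; rewrite -card_gt0 cA'.
have modU1 i' := mxsimple_module (simU1 i').
have [V1 [modV1 sum1 cap1 _]] := direct_sum_complement i1 modU1 sumU1 dxU1.
have [_ eqW] := common_constituents_eq modVi modV1 (simW j) (simW1 j1)
    sumi capi sum1 cap1
    (mx_rsim_trans simi (mx_rsim_sym simj))
    (mx_rsim_trans simi1 (mx_rsim_sym simj1)).
apply: mx_rsim_trans simj; apply: mx_rsim_trans (submod_rsim modj1 _ _).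
  exact: mx_rsim_sym.
exact: eqmx_sym.
Qed.
End Intertwiners.

(** * Induction of one-dimensional representations *)

Section InducedFromCharacter.

Variables (F : fieldType) (gT : finGroupType) (G H : {group gT}).
Hypothesis sHG : H \subset G.
Variable chi : mx_representation F H 1.

Local Notation ind := (ind_repr sHG chi).
Local Notation N := (\sum_(i < #|rcosets H G|) 1)%N.

(** The basis vectors of a module induced from a one-dimensional one are
indexed by a sum of ones, which is in bijection with the cosets. *)
Definition coset_at (p : 'I_N) : gT := coset_rep (tagnat.sig1 p).

Lemma coset_at_in p : coset_at p \in G.
Proof. by have [] := coset_repP sHG (tagnat.sig1 p). Qed.

Lemma coset_at_mem p q : ((coset_at p * (coset_at q)^-1)%g \in H) = (p == q).
Proof.
rewrite coset_rep_mem //; apply/eqP/eqP => [eqpq|-> //].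
by apply: val_inj; rewrite /= tagnat.rect [RHS]tagnat.rect eqpq !ord1.
Qed.

Lemma coset_at_decomposition y : y \in G ->
  exists q, exists2 h, h \in H & y = (h * coset_at q)%g.
Proof.
move=> Gy; have [j jP] := coset_rep_exists sHG Gy.
exists (@tagnat.Rank _ (fun=> 1%N) j ord0), (y * (coset_rep j)^-1)%g.
  by rewrite jP.
by rewrite /coset_at tagnat.Rank1K mulgKV.
Qed.

Lemma ind_entry x p q :
  ind x p q = let h := (coset_at p * x * (coset_at q)^-1)%g in
              if h \in H then chi h 0 0 else 0.
Proof.
by rewrite mxE /=; case: ifP => _; rewrite ?mxE // !ord1.
Qed.

(** The coset [H] itself, whose canonical representative is the identity. *)
Lemma base_index_exists : exists p, coset_at p = 1%g.
Proof.
have HR : (H : {set gT}) \in rcosets H G.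
  by apply/rcosetsP; exists 1%g; rewrite ?rcoset1.
exists (tagnat.Rank (enum_rank_in HR (H : {set gT})) ord0).
rewrite /coset_at /coset_rep tagnat.Rank1K enum_rankK_in //.
by rewrite /repr group1.
Qed.

(** The matrices of the induced representation are monomial. The row version
describes the image of a basis vector, and the column version the image of a
coordinate function. *)
Lemma ind_row p x h q : h \in H -> (coset_at p * x = h * coset_at q)%g ->
  row p (ind x) = chi h 0 0 *: delta_mx 0 q.
Proof.
move=> Hh px; apply/rowP=> k; rewrite mxE ind_entry px -mulgA /=.
rewrite groupMl // coset_at_mem !mxE eqxx /= eq_sym.
by case: eqP => [->|_]; rewrite ?mulr0 // mulgV mulg1 mulr1.
Qed.

Lemma ind_col p x h q : h \in H -> (coset_at p * x = h * coset_at q)%g ->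
  col q (ind x) = chi h 0 0 *: delta_mx p 0.
Proof.
move=> Hh px; apply/colP=> k; rewrite mxE ind_entry /=.
have -> : (coset_at k * x * (coset_at q)^-1
           = coset_at k * (coset_at p)^-1 * h)%g.
  by rewrite -[x in LHS](mulKg (coset_at p)) px !mulgA mulgK.
rewrite groupMr // coset_at_mem !mxE eqxx andbT.
by case: eqP => [->|_]; rewrite ?mulr0 // mulgV mul1g mulr1.
Qed.

(** Frobenius reciprocity: a vector [w] of type [chi] under [H] defines a map
from the induced module, that sends the basis vector of the coset of [r] to
[w] moved by [r]. *)
Lemma Frobenius_hom d (pi : mx_representation F G d) (w : 'rV_d) :
  (forall h, h \in H -> w *m pi h = chi h 0 0 *: w) -> w != 0 ->
  exists2 B : 'M_(N, d), intertwines ind pi B & B != 0.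
Proof.
move=> semi nzw; exists (\matrix_q (w *m pi (coset_at q))).
  move=> x Gx; apply/row_matrixP=> p; rewrite !row_mul rowK.
  have rG := coset_at_in.
  have [q [h Hh pxE]] := coset_at_decomposition (groupM (rG p) Gx).
  rewrite (ind_row Hh pxE) -scalemxAl -rowE rowK -mulmxA -repr_mxM // pxE.
  by rewrite repr_mxM ?(subsetP sHG h) // [RHS]mulmxA (semi h Hh) -scalemxAl.
have [p p1] := base_index_exists.
apply: contraNneq nzw => /row_matrixP/(_ p).
by rewrite rowK row0 p1 repr_mx1 mulmx1 => ->.
Qed.

End InducedFromCharacter.

(** * Intertwiners between two induced representations *)

Section InducedHoms.

Variables (F : fieldType) (gT : finGroupType) (G H K : {group gT}).
Hypotheses (sHG : H \subset G) (sKG : K \subset G).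
Variables (chi : mx_representation F H 1) (psi : mx_representation F K 1).

Local Notation indH := (ind_repr sHG chi).
Local Notation indK := (ind_repr sKG psi).

Local Notation NH := (\sum_(i < #|rcosets H G|) 1)%N.
Local Notation NK := (\sum_(i < #|rcosets K G|) 1)%N.

Lemma mulmx_entry m n k l (A : 'M[F]_(m, n)) (M : 'M_(n, k)) (C : 'M_(k, l))
    i j :
  (A *m M *m C) i j = (row i A *m M *m col j C) 0 0.
Proof.
rewrite -row_mul [LHS]mxE [RHS]mxE; apply: eq_bigr => r _.
by rewrite [row _ _ _ _]mxE [col _ _ _ _]mxE.
Qed.

(** The entry of [B *m indK g] at the base cosets, as a function of [g], is
the function on the group that represents [B] in Mackey's description of the
intertwiners. Its equivariance comes from the base vector and the base
coordinate being of type [chi] and [psi]. *)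
Lemma hom_entry_double_coset (p : 'I_NH) (q : 'I_NK) B (h g k : gT) :
  coset_at p = 1%g -> coset_at q = 1%g -> intertwines indH indK B ->
  h \in H -> g \in G -> k \in K ->
  (B *m indK (h * g * k)%g) p q = chi h 0 0 * psi k 0 0 * (B *m indK g) p q.
Proof.
move=> p1 q1 homB Hh Gg Kk.
have [Gh Gk] : h \in G /\ k \in G by rewrite (subsetP sHG) ?(subsetP sKG).
have -> : B *m indK (h * g * k)%g = indH h *m (B *m indK g) *m indK k.
  by rewrite !repr_mxM ?groupM // !mulmxA homB.
have rowp := @ind_row _ _ _ _ sHG chi p h h p Hh.
have colq := @ind_col _ _ _ _ sKG psi q k k q Kk.
move: (B *m indK g) => M.
rewrite mulmx_entry rowp ?colq ?p1 ?q1 ?mul1g ?mulg1 // -!scalemxAl -scalemxAr.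
by rewrite -rowE -colE !mxE mulrA.
Qed.

(** The base vector generates the induced module, and the base coordinate
generates its dual; so the function attached to [B] determines all the
entries of [B]. *)
Lemma hom_vanishes (p : 'I_NH) (q : 'I_NK) B :
  coset_at p = 1%g -> coset_at q = 1%g -> intertwines indH indK B ->
  (forall g, g \in G -> (B *m indK g) p q = 0) -> B = 0.
Proof.
move=> p1 q1 homB B0; apply/matrixP=> i j; rewrite [RHS]mxE.
have [Gi Gj] := (coset_at_in sHG i, coset_at_in sKG j).
have Gjv := groupVr Gj.
have := B0 _ (groupM Gi Gjv).
rewrite repr_mxM // mulmxA -homB //.
have rowi : row p (indH (coset_at i)) = delta_mx 0 i.
  by rewrite (@ind_row _ _ _ _ sHG chi p _ 1%g i) ?p1 // repr_mx1 mxE scale1r.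
have colj : col q (indK (coset_at j)^-1%g) = delta_mx j 0.
  rewrite (@ind_col _ _ _ _ sKG psi j _ 1%g q) ?q1 ?mulgV ?mulg1 //.
  by rewrite repr_mx1 mxE scale1r.
by rewrite mulmx_entry rowi colj -rowE -colE !mxE.
Qed.

(** The double cosets other than [H * K] carry no equivariant function, since
[h * g = g * k] gives two different multiples of the value at [g]; what is
left is the value at the identity, that is the base entry of [B]. *)
Lemma hom_le1_of_double_cosets :
  (forall g, g \in G ->
    (exists h k, [/\ h \in H, k \in K & g = h * k]%g) \/
    (exists h k, [/\ h \in H, k \in K, h * g = g * k
                   & chi h 0 0 != psi k 0 0]%g)) ->
  forall B1 B2, intertwines indH indK B1 -> intertwines indH indK B2 ->
  B1 != 0 -> exists c, B2 = c *: B1.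
Proof.
move=> dcos; have chi1 : chi 1%g 0 0 = 1 by rewrite repr_mx1 mxE.
have psi1 : psi 1%g 0 0 = 1 by rewrite repr_mx1 mxE.
have [p p1] := base_index_exists G H; have [q q1] := base_index_exists G K.
have det B : intertwines indH indK B -> B p q = 0 -> B = 0.
  move=> homB B0; apply: (hom_vanishes p1 q1 homB) => g Gg.
  have [[h [k [Hh Kk ->]]] | [h [k [Hh Kk hg neq]]]] := dcos g Gg.
    rewrite -[h]mulg1 (hom_entry_double_coset p1 q1 homB) // repr_mx1 mulmx1.
    by rewrite B0 mulr0.
  have := hom_entry_double_coset p1 q1 homB Hh Gg (group1 K).
  rewrite mulg1 hg psi1 mulr1.
  have := hom_entry_double_coset p1 q1 homB (group1 H) Gg Kk.
  rewrite mul1g chi1 mul1r => -> /eqP.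
  by rewrite -subr_eq0 -mulrBl mulf_eq0 subr_eq0 eq_sym (negPf neq) => /eqP.
move=> B1 B2 hom1 hom2 nzB1.
have nz : B1 p q != 0 by apply: contraNneq nzB1 => /(det _ hom1)->.
exists (B2 p q / B1 p q); apply/eqP; rewrite -subr_eq0; apply/eqP/det.
  move=> x Gx; rewrite mulmxBr mulmxBl hom2 // -scalemxAr -scalemxAl hom1 //.
by rewrite !mxE divfK // subrr.
Qed.

End InducedHoms.

(** * Fillings, and the product of the row and column groups *)

Section Fillings.

Variables (n : nat) (lam : seq nat).
Hypothesis part : is_partition n lam.
Local Open Scope nat_scope.

Lemma part_nth_le r r' : r <= r' -> nth 0 lam r' <= nth 0 lam r.
Proof.
have /and3P[srt _ _] := part.
have [r'l | ] := ltnP r' (size lam); last by move=> ? _; rewrite nth_default.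
move=> rr'; apply: (sorted_leq_nth _ _ 0 srt) => //.
- by move=> x y z; rewrite /geq /=; lia.
- by move=> x; rewrite /geq /=.
- by rewrite inE (leq_ltn_trans rr').
Qed.

Lemma diagram_down (c c' : 'I_n * 'I_n) :
  c \in diagram n lam -> c'.1 <= c.1 -> c'.2 <= c.2 -> c' \in diagram n lam.
Proof.
rewrite !inE => cl /part_nth_le le1 le2.
exact: leq_ltn_trans le2 (leq_trans cl le1).
Qed.

Variable t : {ffun 'I_n -> 'I_n * 'I_n}.
Hypothesis fill : is_filling lam t.

Lemma filling_inj : injective t.
Proof. by apply/injectiveP; case/andP: fill. Qed.

Lemma filling_mem i : t i \in diagram n lam.
Proof. by case/andP: fill => _ /eqP <-; apply: imset_f. Qed.

Lemma filling_onto c : c \in diagram n lam -> exists i, t i = c.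
Proof. by case/andP: fill => _ /eqP <- /imsetP[i _ ->]; exists i. Qed.

(** The factor [h] has to move the entry [i] inside its row to the column
where [g] sends it. The only issue is whether the cell in that row and column
belongs to the diagram. Suppose that it does not for [i0], in row [r] of
length [m]. In the rows above [r], which are at least as long as [m], [g]
sends at most as many entries to the first [m] columns as there were before,
since the map from [i] to the cell in its row and new column is injective.
So [g] sends at least as many entries of these rows beyond the first [m]
columns as there were before. These already are all the entries of the
diagram beyond the first [m] columns, which leaves no place for [i0]. *)
Lemma row_col_factorization (g : 'S_n) :
  (forall a b, (t a).1 = (t b).1 -> (t (g a)).2 = (t (g b)).2 -> a = b) ->
  exists h k, [/\ h \in row_group t, k \in col_group t & g = h * k]%g.
Proof.
move=> inj.
pose c i := ((t i).1, (t (g i)).2).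
have c_in i0 : c i0 \in diagram n lam.
  apply: contraT; rewrite inE -leqNgt /= => out.
  set r := (t i0).1 in out; set m := nth 0 lam r in out.
  pose A := [set i | ((t i).1 < r) && ((t (g i)).2 < m)].
  pose B := [set i | ((t i).1 < r) && ((t i).2 < m)].
  have leAB : #|A| <= #|B|.
    have cB i : i \in A -> exists j, t j = c i.
      rewrite inE => /andP[ir im]; apply: filling_onto.
      by rewrite inE /=; apply: leq_trans im (part_nth_le (ltnW ir)).
    pose f i := odflt i [pick j | t j == c i].
    have fP i : i \in A -> t (f i) = c i.
      move=> iA; rewrite /f; case: pickP => [j /eqP //|no].
      by have [j jc] := cB i iA; have := no j; rewrite jc eqxx.
    have f_inj : {in A &, injective f}.
      move=> i j iA jA fij; have := fP i iA; rewrite fij fP // => [[e1 e2]].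
      by apply: inj; rewrite ?e1 ?e2.
    rewrite -(card_in_imset f_inj); apply/subset_leq_card.
    apply/subsetP=> _ /imsetP[i iA ->].
    by move: (iA); rewrite !inE (fP i iA).
  (* C collects the entries that g sends beyond the first m columns. *)
  pose C := [set i : 'I_n | m <= (t (g i)).2]; pose D := [set i | m <= (t i).2].
  have cardCD : #|C| = #|D|.
    have -> : C = g @^-1: D by apply/setP=> i; rewrite !inE.
    by rewrite card_preimset //; exact: perm_inj.
  pose L := [set i | (t i).1 < r].
  have DL : D \subset L.
    apply/subsetP=> i; rewrite !inE => mi; have := filling_mem i; rewrite inE.
    by move=> il; rewrite ltnNge; apply/negP=> /part_nth_le; rewrite -/m; lia.
  have cL : #|L| = #|A| + #|L :&: C|.
    rewrite -(cardsID C L) addnC; congr (_ + _).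
    by apply: eq_card => i; rewrite !inE -ltnNge andbC.
  have cL' : #|L| = #|B| + #|D|.
    rewrite -(cardsID D L) (setIidPr DL) addnC; congr (_ + _).
    by apply: eq_card => i; rewrite !inE -ltnNge andbC.
  have leCL : #|C| <= #|L :&: C| by lia.
  have LC : L :&: C = C by apply/eqP; rewrite eqEcard subsetIr.
  have : i0 \in L :&: C by rewrite LC inE.
  by rewrite !inE ltnn.
have c_inj : injective c.
  by move=> i j [e1 e2]; apply: inj.
have ex i : {j | t j == c i}.
  by apply/sigW; have [j] := filling_onto (c_in i); exists j; apply/eqP.
pose h0 i := sval (ex i).
have h0P i : t (h0 i) = c i by rewrite /h0; case: (ex i) => j /= /eqP.
have h0_inj : injective h0 by move=> i j e; apply: c_inj; rewrite -!h0P e.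
exists (perm h0_inj), ((perm h0_inj)^-1 * g)%g; split.
- by rewrite inE; apply/forallP=> i; rewrite permE h0P.
- rewrite inE; apply/forallP=> i; rewrite permM.
  have := permKV (perm h0_inj) i.
  set j := (perm h0_inj)^-1%g i; clearbody j => <-.
  by rewrite permE h0P.
- by rewrite mulKVg.
Qed.

(** The corner cell in the row of [i] and the column of [j] lies in the
diagram, and its entry is between [i] and [j]. *)
Lemma standard_diagonal i j :
  is_standard lam t -> (t i).1 < (t j).1 -> (t i).2 < (t j).2 -> i < j.
Proof.
case/andP=> _ /forallP std lt1 lt2.
have [k tk] : exists k, t k = ((t i).1, (t j).2).
  apply: filling_onto.
  by apply: diagram_down (filling_mem j) _ _ => //=; apply: ltnW.
have /forallP/(_ k)/andP[/implyP ik _] := std i.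
have /forallP/(_ j)/andP[_ /implyP kj] := std k.
by apply: (@ltn_trans k); [apply: ik | apply: kj]; rewrite tk /= eqxx.
Qed.

End Fillings.

(** * Standard tableaux and contents *)

(** Equality of the contents, with the subtractions cleared. *)
Definition same_diagonal n (c c' : 'I_n * 'I_n) : bool :=
  (c.2 + c'.1 == c'.2 + c.1)%N.

Section Tableaux.
Variables (n : nat) (lam : seq nat).
Hypothesis part : is_partition n lam.
Local Open Scope nat_scope.

Lemma standard_filling t : is_standard lam t -> is_filling (n := n) lam t.
Proof. by case/andP. Qed.

Lemma same_diagonalP (c c' : 'I_n * 'I_n) : same_diagonal c c' ->
  [\/ c = c', c.1 < c'.1 /\ c.2 < c'.2 | c'.1 < c.1 /\ c'.2 < c.2].
Proof.
case: c c' => [a b] [a' b']; rewrite /same_diagonal /= => /eqP e.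
have [lt|lt|eq] := ltngtP a a'.
- by constructor 2; lia.
- by constructor 3; lia.
constructor 1; congr (_, _); apply: val_inj => //=; lia.
Qed.

(** The entries on a diagonal of a standard tableau increase downwards, so the
tableau is determined by the diagonals of its entries: the next entry put on
a diagonal goes to the first free cell. The relabelling [s], increasing on
each diagonal of [T], covers the comparison of two tableaux that differ by an
exchange. *)
Lemma standard_eq_of_diagonals (T T' : {ffun 'I_n -> 'I_n * 'I_n}) (s : 'S_n) :
  is_standard lam T -> is_standard lam T' ->
  (forall i, same_diagonal (T' i) (T (s i))) ->
  (forall i j, same_diagonal (T (s i)) (T (s j)) -> s i < s j -> i < j) ->
  forall i, T' i = T (s i).
Proof.
move=> stdT stdT' diag mono i.
have [fT fT'] := (standard_filling stdT, standard_filling stdT').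
have [m] := ubnP (i : nat); elim: m i => // m IH i; rewrite ltnS => lei.
have [// | [lt1 lt2] | [lt1 lt2]] := same_diagonalP (diag i).
(* The cell of i in T' is above its expected cell: the entry of T there is
   smaller, so it was already placed in that cell of T'. *)
- have [x Tx] : exists x, T x = T' i.
    apply: (filling_onto fT).
    by apply: diagram_down (filling_mem fT (s i)) _ _ => //; apply: ltnW.
  have [y xs] : exists y, x = s y by exists ((s^-1)%g x); rewrite permKV.
  have lty : y < i.
    apply: mono; first by rewrite -xs Tx.
    by rewrite -xs; apply: (standard_diagonal part fT stdT); rewrite Tx.
  have := IH y (leq_trans lty lei); rewrite -xs Tx => /(filling_inj fT') yi.
  by rewrite yi ltnn in lty.
(* The expected cell is above: T' has a smaller entry y there, so by induction
   T has the entry s y there, besides s i. *)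
have [y Ty] : exists y, T' y = T (s i).
  apply: (filling_onto fT').
  by apply: diagram_down (filling_mem fT' i) _ _ => //; apply: ltnW.
have lty : y < i by apply: (standard_diagonal part fT' stdT'); rewrite Ty.
have := IH y (leq_trans lty lei); rewrite Ty => /(filling_inj fT)/perm_inj yi.
by rewrite yi ltnn in lty.
Qed.

(** Neighbouring cells lie on different diagonals, so exchanging their entries
keeps the order on each diagonal. Then [T'] would be [T] with these two
entries exchanged, where they are in the wrong order. *)
Lemma swapped_standard_absurd (T T' : {ffun 'I_n -> 'I_n * 'I_n}) (i j : 'I_n) :
  is_standard lam T -> is_standard lam T' -> j = i.+1 :> nat ->
  (T i).1 = (T j).1 \/ (T i).2 = (T j).2 ->
  (forall k, same_diagonal (T' k) (T (tperm i j k))) -> False.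
Proof.
move=> stdT stdT' ji adj diag.
have fT := standard_filling stdT.
have neTij : T i <> T j by move/(filling_inj fT)=> ij; rewrite ij in ji; lia.
have ndiag : ~~ same_diagonal (T i) (T j).
  apply/negP => /same_diagonalP; case=> //; case: adj => ->; lia.
have ndiag' : ~~ same_diagonal (T j) (T i).
  by move: ndiag; rewrite /same_diagonal eq_sym.
have T'E := standard_eq_of_diagonals stdT stdT' diag.
have {}T'E : forall k, T' k = T (tperm i j k).
  apply: T'E => x y; have [->|->|/eqP xi /eqP xj] := tpermP i j x;
    have [->|->|/eqP yi /eqP yj] := tpermP i j y;
    rewrite ?(negPf ndiag) ?(negPf ndiag') //.
  - by rewrite !ltnn.
  - by move=> _; rewrite -!val_eqE /= in yi yj *; lia.
  - by rewrite !ltnn.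
  - by move=> _; rewrite -!val_eqE /= in yi yj *; lia.
  - by move=> _; rewrite -!val_eqE /= in xi xj *; lia.
  - by move=> _; rewrite -!val_eqE /= in xi xj *; lia.
have ltij : i < j by rewrite ji.
have [/andP[_ /forallP std] /andP[_ /forallP std']] := (stdT, stdT').
have /forallP/(_ i)/andP[/implyP row_ji /implyP col_ji] := std j.
have /forallP/(_ i)/andP[/implyP row_ji' /implyP col_ji'] := std' j.
rewrite !T'E tpermL tpermR in row_ji' col_ji'.
(* Along the line of adj, T increases from i to j, and T' from j to i. *)
suff : j < i by lia.
case: adj => e.
  apply: row_ji'; rewrite e eqxx /= ltn_neqAle; apply/andP; split.
    by apply/eqP=> /val_inj e2; apply: neTij; apply/eqP;
      rewrite -pair_eqE /pair_eq e e2 !eqxx.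
  rewrite leqNgt; apply/negP=> lt.
  by have : j < i; [apply: row_ji; rewrite e eqxx | lia].
apply: col_ji'; rewrite e eqxx /= ltn_neqAle; apply/andP; split.
  by apply/eqP=> /val_inj e2; apply: neTij; apply/eqP;
      rewrite -pair_eqE /pair_eq e e2 !eqxx.
rewrite leqNgt; apply/negP=> lt.
by have : j < i; [apply: col_ji; rewrite e eqxx | lia].
Qed.

End Tableaux.

(** * Reading tableaux and generators of Young subgroups *)

(** The position of [i] in the sorted order is the number of smaller keys. *)
Lemma sorting_perm n (key : 'I_n -> nat) : injective key ->
  exists g : 'S_n, forall i j, (key (g i) < key (g j))%N = (i < j)%N.
Proof.
move=> key_inj; pose A i := [set j | (key j < key i)%N].
have rank_lt i : (#|A i| < n)%N.
  rewrite -[ltnRHS](card_ord n) -cardsT; apply/proper_card/properP; split=> //.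
  by exists i; rewrite !inE ?ltnn.
have rank_mono i j : (key i < key j)%N -> (#|A i| < #|A j|)%N.
  move=> lt; apply/proper_card/properP; split.
    by apply/subsetP=> k; rewrite !inE => /ltn_trans; apply.
  by exists i; rewrite !inE ?ltnn.
have r_inj : injective (fun i => Ordinal (rank_lt i)).
  move=> i j /(congr1 val) /= e; apply: key_inj.
  by have [/rank_mono|/rank_mono|] := ltngtP (key i) (key j); rewrite ?e ?ltnn.
exists (perm r_inj)^-1%g => i j.
rewrite -{2}(permKV (perm r_inj) i) -{2}(permKV (perm r_inj) j) !permE /=.
move: ((perm r_inj)^-1%g i) ((perm r_inj)^-1%g j) => a b.
apply/idP/idP; first exact: rank_mono.
apply: contraTT; rewrite -!leqNgt leq_eqVlt => /orP[/eqP/key_inj-> //|].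
by move/rank_mono/ltnW.
Qed.

(** As [f] is nondecreasing, its fibers are intervals. So the transpositions
in a fiber are obtained from the adjacent ones by conjugation, and any
element of the stabilizer becomes the identity after multiplication by such
transpositions, each of which adds a fixed point. *)
Lemma fiber_stab_generated n (f : 'I_n -> 'I_n) (P : 'S_n -> Prop) :
  (forall i j : 'I_n, (i <= j)%N -> (f i <= f j)%N) ->
  P 1%g -> (forall x y, P x -> P y -> P (x * y)%g) ->
  (forall i j : 'I_n, j = i.+1 :> nat -> f i = f j -> P (tperm i j)) ->
  forall x, x \in fiber_stab f -> P x.
Proof.
move=> f_mono P1 PM Padj.
have Ptrans m (i j : 'I_n) :
    j = (m + i.+1)%N :> nat -> f i = f j -> P (tperm i j).
  elim: m j => [|m IH] j; first exact: Padj.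
  move=> jE fij; have lt : (m + i.+1 < n)%N by have := ltn_ord j; lia.
  pose k := Ordinal lt; have fik : f i = f k.
    apply: val_inj; apply/eqP; rewrite eqn_leq /= {2}fij !f_mono //= ?jE; lia.
  have Pkj : P (tperm k j) by apply: Padj; rewrite -?fik //= jE; lia.
  have -> : tperm i j = (tperm k j * (tperm i k * tperm k j))%g.
    rewrite -{1}(tpermV k j) -conjgE tpermJ tpermL tpermD //.
    - by rewrite -val_eqE /=; lia.
    - by rewrite -val_eqE /=; lia.
  by apply: (PM _ _ Pkj); apply: PM => //; apply: IH.
have Pt i j : f i = f j -> P (tperm i j).
  move=> fij; have [lt|lt|e] := ltngtP i j.
  - by apply: (Ptrans (j - i.+1)%N) => //; lia.
  - by rewrite tpermC; apply: (Ptrans (i - j.+1)%N) => //; lia.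
  - by rewrite (val_inj e) tperm1.
move=> x; have [m] := ubnP #|[set i | x i != i]|; elim: m x => // m IH x lt_m.
have [i /eqP xi | fix_x] := pickP (fun i => x i != i); last first.
  move=> _; suff -> : x = 1%g by [].
  by apply/permP=> i; rewrite perm1; have /negbFE/eqP := fix_x i.
rewrite inE => /forallP fx.
have -> : x = ((x * tperm i (x i)) * tperm i (x i))%g.
  by rewrite -mulgA tperm2 mulg1.
apply: PM; last by apply: Pt; rewrite (eqP (fx i)).
apply: IH; last first.
  rewrite inE; apply/forallP=> k; rewrite permM.
  have [e|e|_ _] := tpermP i (x i) (x k); last exact: fx.
    by rewrite -(eqP (fx k)) e fx.
  by rewrite -(eqP (fx k)) e (eqP (fx i)).
apply: leq_trans (ltnSE lt_m); apply/proper_card/properP; split.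
  apply/subsetP=> k; rewrite !inE permM; apply: contraNneq => xk.
  have ik : i != k by apply/eqP=> ik; apply: xi; rewrite ik xk.
  have xik : x i != k by rewrite -xk (inj_eq perm_inj).
  by rewrite xk tpermD.
exists i; rewrite !inE ?permM ?tpermR ?eqxx //.
exact/eqP.
Qed.

(** The row for [b = false] and the column for [b = true]; this makes rows
and columns instances of the same statements. *)
Definition line n (b : bool) (c : 'I_n * 'I_n) : 'I_n := if b then c.2 else c.1.

Section Reading.
Variables (n : nat) (lam : seq nat).
Hypothesis part : is_partition n lam.
Variable t : {ffun 'I_n -> 'I_n * 'I_n}.
Hypothesis fill : is_filling lam t.

Lemma line_inj b (c c' : 'I_n * 'I_n) :
  line b c = line b c' -> line (~~ b) c = line (~~ b) c' -> c = c'.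
Proof. by case: c c' b => [x y] [x' y'] [] /= -> ->. Qed.

Lemma line_surj b (x y : 'I_n) : exists c, line b c = x /\ line (~~ b) c = y.
Proof. by case: b; [exists (y, x) | exists (x, y)]. Qed.

Lemma diagram_down_line b (c c' : 'I_n * 'I_n) : c \in diagram n lam ->
  (line b c' <= line b c)%N -> (line (~~ b) c' <= line (~~ b) c)%N ->
  c' \in diagram n lam.
Proof. by case: b => /= ? ? ?; apply: (@diagram_down _ _ part c). Qed.

(** The tableau numbers the cells in the lexicographic order of
[line b] and [line (~~ b)], that is row by row or column by column. *)
Lemma reading_tableau b : exists (g : 'S_n) (T : {ffun 'I_n -> 'I_n * 'I_n}),
  [/\ is_standard lam T, forall i, T i = t (g i),
      forall i j : 'I_n, (i <= j)%N -> (line b (T i) <= line b (T j))%N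
    & forall i j : 'I_n, j = i.+1 :> nat -> line b (T i) = line b (T j) ->
      line (~~ b) (T j) = (line (~~ b) (T i)).+1 :> nat].
Proof.
(* Lexicographic comparison, since both coordinates are smaller than n. *)
pose key i := (line b (t i) * n + line (~~ b) (t i))%N.
have keyE i j : (key i < key j)%N = (line b (t i) < line b (t j))%N ||
   ((line b (t i) == line b (t j))
    && (line (~~ b) (t i) < line (~~ b) (t j))%N).
  have := ltn_ord (line (~~ b) (t i)); have := ltn_ord (line (~~ b) (t j)).
  rewrite /key -val_eqE; case: ltngtP => /= c; nia.
have key_inj : injective key.
  move=> i j kij; apply: (filling_inj fill).
  have := keyE i j; have := keyE j i; rewrite kij ltnn.
  have [//|//|/val_inj e] := ltngtP (line b (t i)) (line b (t j)).
  rewrite e eqxx /=.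
  have [//|//|/val_inj e' _ _] :=
    ltngtP (line (~~ b) (t i)) (line (~~ b) (t j)).
  exact: line_inj e e'.
have [g gP] := sorting_perm key_inj.
pose T := [ffun i => t (g i)]; have TE i : T i = t (g i) by rewrite ffunE.
have ltE (i j : 'I_n) : (i < j)%N = (line b (T i) < line b (T j))%N ||
   ((line b (T i) == line b (T j))
    && (line (~~ b) (T i) < line (~~ b) (T j))%N).
  by rewrite -gP keyE !TE.
have fillT : is_filling lam T.
  apply/andP; split.
    by apply/injectiveP => i j; rewrite !TE => /(filling_inj fill)/perm_inj.
  apply/eqP/setP=> c; apply/imsetP/idP => [[i _ ->]|/(filling_onto fill)[i <-]].
    by rewrite TE filling_mem.
  by exists (g^-1%g i) => //; rewrite TE permKV.
have Tmono (i j : 'I_n) : (i <= j)%N -> (line b (T i) <= line b (T j))%N.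
  by rewrite [(i <= j)%N]leqNgt ltE negb_or -leqNgt => /andP[].
exists g, T; split=> //.
- rewrite /is_standard fillT; apply/forallP=> i; apply/forallP=> j.
  rewrite !(ltE i j).
  by apply/andP; split; apply/implyP=> /andP[/eqP e lt]; case: (b);
    rewrite /= lt e ?eqxx ?orbT.
- move=> i j ji e; apply/eqP; rewrite eqn_leq.
  have lt : (line (~~ b) (T i) < line (~~ b) (T j))%N.
    have := ltE i j; rewrite ji ltnSn e ltnn eqxx /=; exact/esym.
  rewrite lt andbT leqNgt; apply/negP=> gap.
  have bnd : ((line (~~ b) (T i)).+1 < n)%N by apply: ltn_trans gap _.
  have [c [c1 c2]] := line_surj b (line b (T i)) (Ordinal bnd).
  have [k Tk] : exists k, T k = c.
    apply: (filling_onto fillT).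
    apply: (diagram_down_line (b := b) (filling_mem fillT j)).
      by rewrite c1 e.
    by rewrite c2 /=; apply: ltnW.
  have : (i < k)%N by rewrite ltE Tk c1 c2 eqxx /= ltnSn orbT.
  have : (k < j)%N by rewrite ltE Tk c1 c2 e eqxx /= gap orbT.
  by rewrite ji; lia.
Qed.

End Reading.

(** * Jucys-Murphy elements and adjacent transpositions *)

Section JucysMurphy.

Variables (F : fieldType) (n d : nat).
Variable pi : mx_representation F [set: 'S_n] d.

Let piM (x y : 'S_n) : pi (x * y)%g = pi x *m pi y.
Proof. by rewrite repr_mxM ?inE. Qed.

Lemma conj_jucys_murphy (s : 'S_n) k :
  pi s^-1%g *m jucys_murphy pi k *m pi s =
    \sum_(l < n | (l < k)%N) pi (tperm (s l) (s k)).
Proof.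
rewrite mulmx_sumr mulmx_suml; apply: eq_bigr => l _.
by rewrite -!piM -mulgA -conjgE tpermJ.
Qed.

Variables i j : 'I_n.
Hypothesis ji : j = i.+1 :> nat.
Let s : 'S_n := tperm i j.

Let pis2 : pi s *m pi s = 1%:M.
Proof. by rewrite -piM tperm2 repr_mx1. Qed.

(** Conjugation by [s] turns the terms of [X_i] into the terms of [X_(i+1)]
other than [s] itself. This is the defining relation of the degenerate affine
Hecke algebra. *)
Lemma jucys_murphy_conj_adjacent :
  pi s *m jucys_murphy pi i *m pi s = jucys_murphy pi j - pi s.
Proof.
have := conj_jucys_murphy s i; rewrite tpermV tpermL => ->.
rewrite /jucys_murphy [in RHS](bigD1 i) /=; last by rewrite ji.
rewrite [RHS]addrC addKr; apply: eq_big => l.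
  by rewrite -val_eqE /=; lia.
move=> li; rewrite tpermD // -val_eqE /=; lia.
Qed.

(** Conjugation by [s] permutes the terms of [X_k], since [i] and [i + 1] are
either both smaller than [k] or both greater. *)
Lemma jucys_murphy_commute k : k != i -> k != j ->
  pi s *m jucys_murphy pi k = jucys_murphy pi k *m pi s.
Proof.
move=> ki kj; have := conj_jucys_murphy s k; rewrite tpermV => E.
suff sXs : pi s *m jucys_murphy pi k *m pi s = jucys_murphy pi k.
  by rewrite -[in RHS]sXs -[RHS]mulmxA pis2 mulmx1.
rewrite E /jucys_murphy [RHS](reindex_inj (@perm_inj _ s)) /=.
rewrite [s k]tpermD; rewrite 1?eq_sym //; apply: eq_bigl => l.
rewrite -!val_eqE /= in ki kj.
have [->|->|_ _] := tpermP i j l; lia.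
Qed.

(** In the plane spanned by [v] and [v s], when the eigenvalues of [X_i] and
[X_(i+1)] on [v] differ by a sign [eps], the vector [v s - eps v] is zero or
again a joint eigenvector, with the two eigenvalues exchanged. *)
Lemma adjacent_defect_weights (v : 'rV_d) (a : 'I_n -> F) eps :
  (forall k, v *m jucys_murphy pi k = a k *: v) ->
  eps ^+ 2 = 1 -> a j = a i + eps ->
  let u := v *m pi s - eps *: v in
  forall k, u *m jucys_murphy pi k = a (s k) *: u.
Proof.
move=> va eps2 aj u k.
have XiE : pi s *m jucys_murphy pi i = jucys_murphy pi j *m pi s - 1%:M.
  rewrite -pis2 -mulmxBl -jucys_murphy_conj_adjacent.
  by rewrite -[RHS]mulmxA pis2 mulmx1.
have XjE : pi s *m jucys_murphy pi j = jucys_murphy pi i *m pi s + 1%:M.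
  apply/eqP; rewrite -subr_eq -pis2 -mulmxBr -jucys_murphy_conj_adjacent.
  by rewrite !mulmxA pis2 mul1mx.
rewrite mulmxBl -scalemxAl va scalerBr scalerA.
have [->|->|/eqP ki /eqP kj] := tpermP i j k.
- rewrite -mulmxA XiE mulmxBr mulmxA va mulmx1 -scalemxAl aj.
  rewrite -addrA -opprD; congr (_ - _).
  by rewrite scalerA mulrDl -expr2 eps2 scalerDl scale1r addrC mulrC.
- rewrite -mulmxA XjE mulmxDr mulmxA va mulmx1 -scalemxAl.
  rewrite aj mulrDr -expr2 eps2 scalerDl scale1r scalerA [a i * eps]mulrC.
  by rewrite [_ *: v + v]addrC addrKA.
- by rewrite -mulmxA jucys_murphy_commute // mulmxA va -scalemxAl mulrC scalerA.
Qed.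

End JucysMurphy.

Section Weights.
Variables (F : fieldType) (n : nat) (lam : seq nat) (d : nat).
Variable pi : mx_representation F [set: 'S_n] d.

(** On an eigenbasis, the basis vectors that occur in a joint eigenvector have
the same eigenvalues. *)
Lemma weight_of_tableau (v : syt n lam -> 'rV[F]_d) (u : 'rV_d)
    (w : 'I_n -> F) :
  basis_of {: 'rV[F]_d} [seq v T | T : syt n lam] ->
  (forall (T : syt n lam) i,
      v T *m jucys_murphy pi i = content F (sval T i) *: v T) ->
  u != 0 -> (forall i, u *m jucys_murphy pi i = w i *: u) ->
  exists T : syt n lam, forall i, content F (sval T i) = w i.
Proof.
move=> bv vX nzu uX.
pose X := [tuple of [seq v T | T : syt n lam]].
have bX : basis_of {: 'rV[F]_d} X by [].
have XE (k : 'I_#|{: syt n lam}|) : X`_k = v (enum_val k).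
  by rewrite (nth_map (enum_val k)) -?cardE // -enum_val_nth.
have uE := coord_basis bX (memvf u).
have [k nzk | c0] := pickP (fun k => coord X k u != 0); last first.
  case/eqP: nzu; rewrite uE big1 // => k _.
  by have /negbFE/eqP -> := c0 k; rewrite scale0r.
exists (enum_val k) => i; apply: (mulIf nzk).
have := congr1 (coord X k) (uX i); rewrite linearZ /= => <-.
rewrite {2}uE mulmx_suml.
transitivity (coord X k
  (\sum_l (coord X l u * content F (sval (enum_val l) i)) *: X`_l)).
  by rewrite coord_sum_free ?(basis_free bX) // mulrC.
congr (coord X k _); apply: eq_bigr => l _.
by rewrite -scalemxAl XE vX scalerA.
Qed.

End Weights.

(** * Semi-invariant vectors, and the theorem *)

Section SemiInvariants.
Variables (F : fieldType) (n : nat) (lam : seq nat).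
Hypothesis char0 : [pchar F] =i pred0.
Hypothesis part : is_partition n lam.

Lemma natf_inj (a b : nat) : a%:R = b%:R :> F -> a = b.
Proof.
wlog ab : a b / (a <= b)%N => [H e|].
  by have [/H->|/ltnW/H->] := leqP a b.
move=> /eqP; rewrite eq_sym -subr_eq0 -natrB // ((pcharf0P F).1 char0).
by move=> /eqP; lia.
Qed.

Lemma same_diagonal_content (c c' : 'I_n * 'I_n) :
  content F c = content F c' -> same_diagonal c c'.
Proof.
move=> /eqP; rewrite /content subr_eq addrAC eq_sym subr_eq -!natrD.
by move=> /eqP/natf_inj/esym/eqP.
Qed.

(** On the vector of the reading tableau, the adjacent transpositions inside
a line act by the content step along this line, which is [1] in a row and
[-1] in a column. The permutation that carries the reading tableau to [t]
then moves this vector to the required one. *)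
Lemma semi_invariant_exists (t : {ffun 'I_n -> 'I_n * 'I_n}) d
    (pi : mx_representation F [set: 'S_n] d) (b : bool) :
  is_filling lam t -> is_irr_of_shape pi lam ->
  exists2 w : 'rV_d, w != 0 &
    forall x, x \in fiber_stab (fun i => line b (t i)) ->
      w *m pi x = (-1) ^+ (b && odd_perm x) *: w.
Proof.
move=> fill [_ [v [bv vX]]].
have piM (x y : 'S_n) : pi (x * y)%g = pi x *m pi y by rewrite repr_mxM ?inE.
have [g [T [stdT TE Tmono Tadj]]] := reading_tableau part fill b.
pose T0 : syt n lam := exist _ T stdT.
have nzv : v T0 != 0.
  exact: (basis_not0 bv (image_f _ _)).
have adj (i j : 'I_n) : j = i.+1 :> nat -> line b (T i) = line b (T j) ->
    v T0 *m pi (tperm i j) = (-1) ^+ b *: v T0.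
  move=> ji Tij; apply/eqP; rewrite -subr_eq0; apply/negPn/negP=> nzu.
  have aj : content F (T j) = content F (T i) + (-1) ^+ b.
    have := Tadj _ _ ji Tij; rewrite /content; case: (b) Tij => /= -> ->.
      by rewrite -addn1 natrD opprD addrA.
    by rewrite -addn1 natrD expr0 addrAC.
  have eps2 : ((-1) ^+ b) ^+ 2 = 1 :> F by rewrite sqrr_sign.
  have uX := adjacent_defect_weights ji (vX T0) eps2 aj.
  have [[T' stdT'] T'w] := weight_of_tableau bv vX nzu uX.
  apply: (swapped_standard_absurd part stdT stdT' ji) => [|k].
    by case: (b) Tij => /= e; [right | left].
  exact/same_diagonal_content/T'w.
have inv x : x \in fiber_stab (fun i => line b (T i)) ->
    v T0 *m pi x = (-1) ^+ (b && odd_perm x) *: v T0.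
  pose P x := v T0 *m pi x = (-1) ^+ (b && odd_perm x) *: v T0.
  apply: (fiber_stab_generated (P := P)) => //; rewrite /P.
  - by rewrite repr_mx1 mulmx1 odd_perm1 andbF scale1r.
  - move=> {}x y vx vy; rewrite piM mulmxA vx -scalemxAl vy scalerA.
    by rewrite odd_permM -signr_addb; case: (b).
  - move=> i j ji Tij; rewrite adj // odd_tperm -val_eqE /= andbC.
    by case: eqP => // ij; rewrite ij in ji; lia.
exists (v T0 *m pi g).
  apply: contraNneq nzv => v0; rewrite -[v T0]mulmx1 -(repr_mx1 pi) -(mulgV g).
  by rewrite piM mulmxA v0 mul0mx.
move=> x; rewrite inE => /forallP fx.
have -> : v T0 *m pi g *m pi x = v T0 *m pi (x ^ g^-1)%g *m pi g.
  by rewrite -!mulmxA -!piM conjgE invgK !mulgA mulgKV.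
rewrite inv ?odd_permJ ?scalemxAl // inE; apply/forallP=> i.
by rewrite !TE conjgE invgK !permM permKV fx.
Qed.

End SemiInvariants.

Theorem theorem1 (R : realType) (n : nat) (hn : (0 < n)%N) (lam : seq nat)
  (hlam : is_partition n lam)
  (t : {ffun 'I_n -> 'I_n * 'I_n}) (ht : is_filling lam t)
  (d : nat) (pi : mx_representation (complex R) [set: 'S_n] d)
  (hpi : is_irr_of_shape pi lam) :
  let indH := ind_repr (subsetT (row_group t))
                (triv_repr (complex R) (row_group t)) in
  let indV := ind_repr (subsetT (col_group t))
                (sgn_res (complex R) (col_group t)) in
  [/\ has_multiplicity indH pi 1,
      has_multiplicity indV pi 1
    & forall (e : nat) (rho : mx_representation (complex R) [set: 'S_n] e),
        mx_irreducible rho -> occurs_in rho indH -> occurs_in rho indV ->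
        mx_rsim rho pi].
Proof.
move=> indH indV.
have char0 : [pchar complex R] =i pred0 := Num.Theory.pchar_num _.
have pG : [pchar complex R]^'.-group [set: 'S_n].
  by apply/pgroupP => p _ _; rewrite inE /= char0.
have irr_pi : mx_irreducible pi by case: hpi.
have [w nzw wH] := semi_invariant_exists char0 hlam false ht hpi.
have [w' nzw' wV] := semi_invariant_exists char0 hlam true ht hpi.
have [|P homP nzP] := @Frobenius_hom _ _ _ _ (subsetT _)
  (triv_repr _ (row_group t)) _ pi w _ nzw.
  by move=> h hH; rewrite wH // mxE.
have [|Q homQ nzQ] := @Frobenius_hom _ _ _ _ (subsetT _)
  (sgn_res _ (col_group t)) _ pi w' _ nzw'.
  by move=> h hH; rewrite wV // mxE.
apply: (unique_common_constituent pG _ irr_pi homP nzP homQ nzQ).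
apply: hom_le1_of_double_cosets => g _.
have [[a [b [neq_ab rowab colab]]] | no] :=
  EM (exists a b,
    [/\ a != b, (t a).1 = (t b).1 & (t (g a)).2 = (t (g b)).2]).
  right; exists (tperm a b), (tperm (g a) (g b)); split.
  - rewrite inE; apply/forallP=> k.
    by have [->|->|] := tpermP a b k; rewrite ?rowab.
  - rewrite inE; apply/forallP=> k.
    by have [->|->|] := tpermP (g a) (g b) k; rewrite ?colab.
  - by rewrite -tpermJ conjgE mulgA mulgV mul1g.
  - rewrite !mxE /= odd_tperm (inj_eq perm_inj) neq_ab expr1 -addr_eq0 -mulr2n.
    by rewrite ((pcharf0P _).1 char0).
left; apply: (row_col_factorization hlam ht) => a b rowab colab.
by apply/eqP/negPn/negP=> neq; apply: no; exists a, b.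
Qed.
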